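(* Let $\Lambda'$, $\Lambda$ and $\Lambda''$ be artin algebras such that there is a recollement $(\operatorname{mod}\Lambda',\operatorname{mod}\Lambda,\operatorname{mod}\Lambda'')$ of module categories with functors $i^{*},i_{*},i^{!},j_{!},j^{*},j_{*}$. Let $T'$ and $T''$ be tilting modules in $\operatorname{mod}\Lambda'$ and $\operatorname{mod}\Lambda''$ respectively. Let $(\mathcal{T},\mathcal{F})$ be the glued torsion pair in $\operatorname{mod}\Lambda$ with respect to the torsion pairs $(\operatorname{Gen}T',T'^{\perp_0})$ in $\operatorname{mod}\Lambda'$ and $(\operatorname{Gen}T'',T''^{\perp_0})$ in $\operatorname{mod}\Lambda''$. If $i^{!}$ and $j_{!}$ are exact, then there exists a tilting $\Lambda$-module $T$ of the form $T=j_{!}(T'')\oplus M$, for some $\Lambda$-module $M$, such that $(\mathcal{T},\mathcal{F})=(\operatorname{Gen}T,T^{\perp_0})$.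
   Context: For an artin algebra $\Lambda$, $\operatorname{mod}\Lambda$ is the category of finitely generated left $\Lambda$-modules. All subcategories are full, additive and closed under isomorphisms. Recollement: a recollement $(\mathcal{A},\mathcal{B},\mathcal{C})$ of abelian categories consists of abelian categories $\mathcal{A},\mathcal{B},\mathcal{C}$ and additive functors $i_{*}:\mathcal{A}\to\mathcal{B}$, $i^{*},i^{!}:\mathcal{B}\to\mathcal{A}$, $j^{*}:\mathcal{B}\to\mathcal{C}$, $j_{!},j_{*}:\mathcal{C}\to\mathcal{B}$ such that (1) $(i^{*},i_{*})$, $(i_{*},i^{!})$, $(j_{!},j^{*})$ and $(j^{*},j_{*})$ are adjoint pairs (left adjoint written first); (2) $i_{*}$, $j_{!}$ and $j_{*}$ are fully faithful; (3) $\operatorname{Im} i_{*}=\operatorname{Ker} j^{*}$ (essential image of $i_*$ equals the full subcategory of objects killed by $j^{*}$). Here $\mathcal{A}=\operatorname{mod}\Lambda'$, $\mathcal{B}=\operatorname{mod}\Lambda$, $\mathcal{C}=\operatorname{mod}\Lambda''$. Tilting module: $T\in\operatorname{mod}\Lambda$ is tilting if (T1) its projective dimension satisfies $\operatorname{pd}_{\Lambda}T\le 1$; (T2) $\operatorname{Ext}^1_{\Lambda}(T,T)=0$; (T3) there is an exact sequence $0\to\Lambda\to T_0\to T_1\to 0$ with $T_0,T_1\in\operatorname{add}T$, where $\operatorname{add}T$ is the subcategory of direct summands of finite direct sums of copies of $T$. $\operatorname{Gen}T$ is the class of all $M\in\operatorname{mod}\Lambda$ for which there is an integer $n\ge 0$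 and an epimorphism $T^{n}\to M$. $T^{\perp_0}:=\{M\in\operatorname{mod}\Lambda\mid\operatorname{Hom}_{\Lambda}(T,M)=0\}$. If $T$ is a tilting module, $(\operatorname{Gen}T,T^{\perp_0})$ is a torsion pair in $\operatorname{mod}\Lambda$. Torsion pair: a pair $(\mathcal{T},\mathcal{F})$ of subcategories of an abelian category $\mathcal{A}$ such that $\operatorname{Hom}_{\mathcal{A}}(X,Y)=0$ for all $X\in\mathcal{T}$, $Y\in\mathcal{F}$, and every object $M$ of $\mathcal{A}$ fits in an exact sequence $0\to X\to M\to Y\to 0$ with $X\in\mathcal{T}$, $Y\in\mathcal{F}$. Glued torsion pair: given a recollement $(\mathcal{A},\mathcal{B},\mathcal{C})$ and torsion pairs $(\mathcal{T}',\mathcal{F}')$ in $\mathcal{A}$ and $(\mathcal{T}'',\mathcal{F}'')$ in $\mathcal{C}$, the glued torsion pair in $\mathcal{B}$ with respect to them is $(\mathcal{T},\mathcal{F})$ with $\mathcal{T}=\{B\in\mathcal{B}\mid i^{*}(B)\in\mathcal{T}',\ j^{*}(B)\in\mathcal{T}''\}$ and $\mathcal{F}=\{B\in\mathcal{B}\mid i^{!}(B)\in\mathcal{F}',\ j^{*}(B)\in\mathcal{F}''\}$ (it is known that this is a torsion pair). *)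

(* Defs.v *)
From HB Require Import structures.
From mathcomp Require Import all_boot all_order all_algebra.

Set Implicit Arguments.
Unset Strict Implicit.
Unset Printing Implicit Defensive.

Import GRing.Theory.
Local Open Scope ring_scope.

Definition surjective (X Y : Type) (f : X -> Y) : Prop :=
  forall y, exists x, f x = y.

Definition finitely_generated (R : pzRingType) (M : lmodType R) : Prop :=
  exists (n : nat) (v : 'I_n -> M),
    forall x, exists c : 'I_n -> R, x = \sum_(i < n) c i *: v i.

Definition is_ideal (R : comPzRingType) (I : R -> Prop) : Prop :=
  [/\ I 0, forall x y, I x -> I y -> I (x + y)
    & forall a x, I x -> I (a * x)].

Definition artinian (R : comPzRingType) : Prop :=
  forall I : nat -> R -> Prop,
    (forall n, is_ideal (I n)) ->
    (forall n x, I n.+1 x -> I n x) ->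
    exists N, forall n, (N <= n)%N -> forall x, I N x -> I n x.

Definition artin_algebra (R : comPzRingType) (A : algType R) : Prop :=
  artinian R /\ finitely_generated A.

(* Objects of mod A.  Morphisms are the library's {linear M -> N}.  The ring A
   may be zero. *)
Record fgmod (A : pzRingType) := FgMod {
  fgmod_sort :> lmodType A;
  fgmodP : finitely_generated fgmod_sort }.

Section Modules.
Variable A : pzRingType.
Implicit Types M N P T X Y : fgmod A.

Lemma regular_fg : finitely_generated (A^o : lmodType A).
Proof.
exists 1%N, (fun=> 1 : A^o) => x; exists (fun=> x).
by rewrite big_ord1 -[x in LHS]mulr1.
Qed.

Definition regmod : fgmod A := FgMod regular_fg.

Lemma dsum_fg M N : finitely_generated ((M * N)%type : lmodType A).
Proof.
have [m [u Hu]] := fgmodP M; have [n [v Hv]] := fgmodP N.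
exists (m + n)%N, (fun i => match split i with
  | inl j => (u j, 0) | inr k => (0, v k) end) => -[x y].
have [c ->] := Hu x; have [d ->] := Hv y.
exists (fun i => match split i with inl j => c j | inr k => d k end).
rewrite big_split_ord.
rewrite (eq_bigr (fun i => (c i *: u i, 0))) => [|i _]; last first.
  by rewrite (unsplitK (inl i)) -[LHS]/(_ *: _, _ *: _) /= scaler0.
rewrite [X in _ = _ X](eq_bigr (fun i => (0, d i *: v i))) => [|i _]; last first.
  by rewrite (unsplitK (inr i)) -[LHS]/(_ *: _, _ *: _) /= scaler0.
rewrite [RHS]surjective_pairing.
by congr pair; rewrite /= !raddf_sum /= sumr_const mul0rn ?addr0 ?add0r.
Qed.

Definition dsum M N : fgmod A := FgMod (dsum_fg M N).

Definition isomorphic (M N : lmodType A) : Prop :=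
  exists f : {linear M -> N}, bijective f.

Definition exact_at (X Y Z : lmodType A)
    (f : {linear X -> Y}) (g : {linear Y -> Z}) : Prop :=
  forall y, g y = 0 <-> exists x, f x = y.

Definition short_exact (X Y Z : lmodType A)
    (f : {linear X -> Y}) (g : {linear Y -> Z}) : Prop :=
  [/\ injective f, exact_at f g & surjective g].

Definition zero_module (M : lmodType A) : Prop := forall x : M, x = 0.

Definition projective P : Prop :=
  forall M N (g : {linear M -> N}) (h : {linear P -> N}),
    surjective g -> exists k : {linear P -> M}, forall x, g (k x) = h x.

Record proj_resolution M := ProjResolution {
  res_obj : nat -> fgmod A;
  res_diff : forall n, {linear res_obj n.+1 -> res_obj n};
  res_aug : {linear res_obj 0%N -> M};
  res_proj : forall n, projective (res_obj n);
  res_aug_surj : surjective res_aug;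
  res_exact0 : exact_at (res_diff 0%N) res_aug;
  res_exact : forall n, exact_at (res_diff n.+1) (res_diff n) }.

Definition pd_le M (n : nat) : Prop :=
  exists P : proj_resolution M,
    forall i, (n < i)%N -> zero_module (res_obj P i).

(* Ext^1(M, N) = 0, where Ext^1(M, N) is H^1(Hom(P, N)) for a projective
   resolution P of M: every 1-cocycle is a 1-coboundary.  The vanishing does
   not depend on P. *)
Definition ext1_zero M N : Prop :=
  forall (P : proj_resolution M) (f : {linear res_obj P 1%N -> N}),
    (forall x, f (res_diff P 1%N x) = 0) ->
    exists g : {linear res_obj P 0%N -> N},
      forall x, f x = g (res_diff P 0%N x).

(* {ffun 'I_n -> T} is the direct sum T^n. *)
Definition in_add T M : Prop :=
  exists (n : nat) (N : fgmod A),
    isomorphic (M * N)%type {ffun 'I_n -> T}.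

Definition tilting T : Prop :=
  [/\ pd_le T 1,
      ext1_zero T T
    & exists (T0 T1 : fgmod A)
        (f : {linear regmod -> T0}) (g : {linear T0 -> T1}),
        [/\ in_add T T0, in_add T T1 & short_exact f g]].

Definition subcat := fgmod A -> Prop.

Definition Gen T : subcat := fun M =>
  exists (n : nat) (f : {linear {ffun 'I_n -> T} -> M}), surjective f.

Definition perp0 T : subcat := fun M =>
  forall (f : {linear T -> M}) x, f x = 0.

Definition eq_subcat (C D : subcat) : Prop := forall M, C M <-> D M.

End Modules.

Record functor (A B : pzRingType) := Functor {
  fobj :> fgmod A -> fgmod B;
  fmap : forall M N : fgmod A, {linear M -> N} -> {linear fobj M -> fobj N};
  fmap_id : forall M : fgmod A, fmap (@idfun M : {linear M -> M}) =1 id;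
  fmap_comp : forall (M N P : fgmod A)
      (g : {linear N -> P}) (f : {linear M -> N}),
    fmap (g \o f : {linear M -> P}) =1 fmap g \o fmap f;
  fmap_add : forall (M N : fgmod A) (f g : {linear M -> N}),
    fmap (f \+ g : {linear M -> N}) =1 fmap f \+ fmap g }.

(* F is left adjoint to G: a bijection Hom(F X, Y) -> Hom(X, G Y) natural in
   both variables. *)
Definition adjoint (A B : pzRingType) (F : functor A B) (G : functor B A)
    : Prop :=
  exists phi : forall (X : fgmod A) (Y : fgmod B),
      {linear F X -> Y} -> {linear X -> G Y},
    (forall X Y, bijective (@phi X Y)) /\
    (forall (X X' : fgmod A) (Y Y' : fgmod B) (a : {linear X' -> X})
        (b : {linear Y -> Y'}) (f : {linear F X -> Y}),
      phi X' Y' (b \o (f \o fmap F a) : {linear F X' -> Y'})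
        =1 fmap G b \o (phi X Y f \o a)).

Definition fully_faithful (A B : pzRingType) (F : functor A B) : Prop :=
  forall M N : fgmod A, bijective (@fmap A B F M N).

Definition exact_functor (A B : pzRingType) (F : functor A B) : Prop :=
  forall (X Y Z : fgmod A) (f : {linear X -> Y}) (g : {linear Y -> Z}),
    short_exact f g -> short_exact (fmap F f) (fmap F g).

(* Field names: u = upper, l = lower, so that i_ustar, i_lstar, i_ushriek,
   j_lshriek, j_ustar, j_lstar are i^*, i_*, i^!, j_!, j^*, j_*. *)
Record recollement (A' A A'' : pzRingType) := Recollement {
  i_ustar : functor A A';
  i_lstar : functor A' A;
  i_ushriek : functor A A';
  j_lshriek : functor A'' A;
  j_ustar : functor A A'';
  j_lstar : functor A'' A;
  adj_i_ustar : adjoint i_ustar i_lstar;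
  adj_i_ushriek : adjoint i_lstar i_ushriek;
  adj_j_lshriek : adjoint j_lshriek j_ustar;
  adj_j_lstar : adjoint j_ustar j_lstar;
  ff_i_lstar : fully_faithful i_lstar;
  ff_j_lshriek : fully_faithful j_lshriek;
  ff_j_lstar : fully_faithful j_lstar;
  im_i_ker_j : forall M : fgmod A,
    (exists X : fgmod A', isomorphic (i_lstar X) M)
      <-> zero_module (j_ustar M) }.

Definition glued_torsion (A' A A'' : pzRingType) (r : recollement A' A A'')
    (T' : subcat A') (T'' : subcat A'') : subcat A :=
  fun M => T' (i_ustar r M) /\ T'' (j_ustar r M).

Definition glued_torsionfree (A' A A'' : pzRingType) (r : recollement A' A A'')
    (F' : subcat A') (F'' : subcat A'') : subcat A :=
  fun M => F' (i_ushriek r M) /\ F'' (j_ustar r M).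

(* Main.v *)
Require Import Defs.
From HB Require Import structures.
From mathcomp Require Import all_boot all_order all_algebra.
From mathcomp Require Import boolp.

Set Implicit Arguments.
Unset Strict Implicit.
Unset Printing Implicit Defensive.

Import GRing.Theory.
Local Open Scope ring_scope.

(** Write N = j_!T'' and L = i_*T'.  Adjunction identifies the glued torsion-free
    class with the right Hom-orthogonal of N and L, so N + L would be the tilting
    module were it not that Ext^1(L, N) may be non-zero; the three other Ext^1
    between N and L vanish.  The universal extension 0 -> N^n -> E -> L -> 0
    repairs this: T = N + E has the same right orthogonal as N + L, projective
    dimension at most 1 ([horseshoe]) and no self-extensions
    ([glued_tilting_exists]).  The exactness of j_! and i^! enters here: j_!, and
    i_* as the left adjoint of an exact functor ([il_projective]), turn projective
    presentations of T'' and T' into projective presentations of N and L.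

    That such a T is tilting follows from Bongartz's argument ([bongartz]) once
    Hom(T, Z) = 0 and Ext^1(T, Z) = 0 imply Z = 0.  Indeed these conditions make
    j^*Z orthogonal to T'' in both degrees, so j^*Z = 0 because T'' is tilting
    ([tilting_generates]); then Z = i_*X, and X is orthogonal to T', so X = 0.
    Finally Gen T is the left orthogonal of its right orthogonal
    ([torsion_quotient]), and so is the glued torsion class, so that the equality
    of the torsion-free classes gives that of the torsion classes
    ([glued_torsion_gen]).

    Ext^1(Z, X) is computed as the cokernel of Hom(P0, X) -> Hom(P1, X) for a
    two-term presentation P1 -> P0 of Z.  Here X may be any module, so kernels and
    traces, which are mere submodules of finitely generated modules, never need a
    finite generating set.  The universal extensions are finite because Hom(P1, N)
    is finitely generated over the base ring ([hom_projective_fg]). *)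

(** * Linear maps, quotients and powers *)

Section LinearMaps.
Variable A : pzRingType.
Implicit Types M N X Y Z : lmodType A.

Lemma linear_ext M N (f g : {linear M -> N}) : f =1 g -> f = g.
Proof.
case: f g => [f [[cf] [sf]]] [g [[cg] [sg]]] /= /funext fg.
by subst g; rewrite (Prop_irrelevance cf cg) (Prop_irrelevance sf sg).
Qed.

Definition linear_map M N (f : M -> N) (f_lin : linear f) : {linear M -> N} :=
  HB.pack f (GRing.isLinear.Build A M N *:%R f f_lin).

(** Factorizations, maps out of pushouts and extensions of maps are all obtained
    from linear relations: well-definedness reduces to a trivial fibre over 0. *)
Lemma linear_of_graph M N (G : M -> N -> Prop) :
    (forall x, exists y, G x y) ->
    (forall a x y x' y', G x y -> G x' y' -> G (a *: x + x') (a *: y + y')) ->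
    (forall y, G 0 y -> y = 0) ->
  exists f : {linear M -> N}, forall x y, G x y -> f x = y.
Proof.
move=> /choice[f Gf] GL G0.
have fE x y : G x y -> f x = y.
  move=> Gxy; have := G0 (-1 *: f x + y); rewrite scaleN1r => H.
  apply/esym/eqP; rewrite -subr_eq0 addrC; apply/eqP/H.
  by rewrite -(subrr x) addrC -!scaleN1r; apply: GL.
have f_lin : linear f by move=> a x y; apply: fE; apply: GL.
by exists (linear_map f_lin).
Qed.

Lemma descend M N Z (e : {linear M -> Z}) (f : {linear M -> N}) :
    surjective e -> (forall x, e x = 0 -> f x = 0) ->
  exists g : {linear Z -> N}, forall x, g (e x) = f x.
Proof.
move=> e_surj ker; pose G z y := exists2 x, e x = z & f x = y.
have [|||g gE] := @linear_of_graph _ _ G.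
- by move=> z; have [x <-] := e_surj z; exists (f x), x.
- by move=> a _ _ _ _ [x <- <-] [y <- <-]; exists (a *: x + y); rewrite linearP.
- by move=> _ [x /ker fx0 <-].
by exists g => x; apply: gE; exists x.
Qed.

Lemma corestrict M X Y (i : {linear X -> Y}) (f : {linear M -> Y}) :
    injective i -> (forall x, exists u, i u = f x) ->
  exists g : {linear M -> X}, forall x, i (g x) = f x.
Proof.
move=> i_inj im.
have [|||g gE] := @linear_of_graph _ _ (fun x u => i u = f x).
- exact: im.
- by move=> a x y x' y' xy xy'; rewrite !linearP xy xy'.
- by move=> y iy; apply: i_inj; rewrite iy !linear0.
by exists g => x; have [u iu] := im x; rewrite (gE x u).
Qed.

Lemma linear_inj M N (f : {linear M -> N}) :
  (forall x, f x = 0 -> x = 0) -> injective f.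
Proof.
by move=> f0 x y fxy; apply/subr0_eq/f0; rewrite linearB fxy subrr.
Qed.

Lemma isomorphic_sym M N : isomorphic M N -> isomorphic N M.
Proof.
case=> f [g fK gK].
have g_lin : linear g.
  by move=> a x y; rewrite -[x in LHS]gK -[y in LHS]gK -linearP fK.
by exists (linear_map g_lin); exists f.
Qed.

Lemma isomorphic_of_inj_surj M N (f : {linear M -> N}) :
  injective f -> surjective f -> isomorphic M N.
Proof.
move=> f_inj /choice[g gK]; exists f, g => //.
by move=> x; apply: f_inj.
Qed.

End LinearMaps.

Section Quotient.
Variables (A : pzRingType) (M : lmodType A) (K : M -> Prop).
Hypotheses (K0 : K 0) (KL : forall a x y, K x -> K y -> K (a *: x + y)).

Let KD x y : K x -> K y -> K (x + y).
Proof. by rewrite -[x in K (x + _)]scale1r; apply: KL. Qed.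
Let KZ a x : K x -> K (a *: x).
Proof. by rewrite -[_ *: x]addr0 => Kx; apply: KL. Qed.
Let KN x : K x -> K (- x).
Proof. by rewrite -scaleN1r; apply: KZ. Qed.

Let coset_pred (x y : M) := `[< K (y - x) >].
Let coset_predxx x : coset_pred x x.
Proof. by apply/asboolP; rewrite subrr. Qed.
Let repr x := xchoose (ex_intro (coset_pred x) x (coset_predxx x)).

Let reprP x : K (repr x - x).
Proof. exact: asboolW (xchooseP (ex_intro _ x (coset_predxx x))). Qed.
Let repr_eq x y : K (x - y) -> repr x = repr y.
Proof.
move=> Kxy; apply: eq_xchoose => z; apply/asboolP/asboolP => Kz.
  by rewrite -(subrKA x); apply: KD.
by rewrite -(subrKA y); apply: KD => //; rewrite -opprB; apply: KN.
Qed.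

Let repr_idem x : repr (repr x) == repr x.
Proof. by apply/eqP/repr_eq. Qed.

(** A coset is represented by the element that [xchoose] picks in it; the choice
    only depends on the coset, because [xchoose] only depends on the extent of
    its predicate. *)
Record quot_type := Quot {
  quot_val : M;
  quot_valP : repr quot_val == quot_val }.
HB.instance Definition _ := [isSub for quot_val].
HB.instance Definition _ := [Choice of quot_type by <:].

Let pi x : quot_type := Quot (repr_idem x).
Let piP x y : pi x = pi y <-> K (x - y).
Proof.
split=> [/(congr1 quot_val)/= xy|/repr_eq xy]; last exact: val_inj.
rewrite -(subrKA (repr x)) addrC {1}xy.
by apply: KD => //; rewrite -opprB; apply: KN.
Qed.
Let valK : cancel quot_val pi.
Proof. by move=> x; apply: val_inj; apply/eqP/quot_valP. Qed.

Let qadd x y := pi (quot_val x + quot_val y).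
Let qopp x := pi (- quot_val x).
Let qscale a x := pi (a *: quot_val x).
Let pi_add x y : qadd (pi x) (pi y) = pi (x + y).
Proof. by apply/piP; rewrite opprD addrACA; apply: KD; apply: reprP. Qed.
Let pi_opp x : qopp (pi x) = pi (- x).
Proof. by apply/piP; rewrite -opprD; apply/KN/reprP. Qed.
Let pi_scale a x : qscale a (pi x) = pi (a *: x).
Proof. by apply/piP; rewrite -scalerBr; apply/KZ/reprP. Qed.

Let qaddA : associative qadd.
Proof.
by move=> x y z; rewrite -(valK x) -(valK y) -(valK z) !pi_add addrA.
Qed.
Let qaddC : commutative qadd.
Proof. by move=> x y; rewrite /qadd addrC. Qed.
Let qadd0 : left_id (pi 0) qadd.
Proof. by move=> x; rewrite -(valK x) pi_add add0r. Qed.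
Let qaddN : left_inverse (pi 0) qopp qadd.
Proof. by move=> x; rewrite -(valK x) pi_opp pi_add addNr. Qed.
HB.instance Definition _ :=
  GRing.isZmodule.Build quot_type qaddA qaddC qadd0 qaddN.

Let qscaleA a b x : qscale a (qscale b x) = qscale (a * b) x.
Proof. by rewrite -(valK x) !pi_scale scalerA. Qed.
Let qscale1 : left_id 1 qscale.
Proof. by move=> x; rewrite -(valK x) pi_scale scale1r. Qed.
Let qscaleDr : right_distributive qscale qadd.
Proof.
move=> a x y; rewrite -(valK x) -(valK y).
by rewrite !(pi_add, pi_scale) scalerDr.
Qed.
Let qscaleDl x a b : qscale (a + b) x = qadd (qscale a x) (qscale b x).
Proof. by rewrite -(valK x) !(pi_add, pi_scale) scalerDl. Qed.
HB.instance Definition _ :=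
  GRing.Zmodule_isLmodule.Build A quot_type qscaleA qscale1 qscaleDr qscaleDl.

Lemma quotient_exists : exists (Q : lmodType A) (p : {linear M -> Q}),
  surjective p /\ forall x, p x = 0 <-> K x.
Proof.
have pi_lin : linear pi.
  move=> a x y; transitivity (qadd (qscale a (pi x)) (pi y)) => //.
  by rewrite pi_scale pi_add.
exists quot_type, (linear_map pi_lin); split=> [y|x] /=.
  by exists (quot_val y); apply: valK.
by rewrite -[0]/(pi 0) piP subr0.
Qed.

End Quotient.

Section FinitelyGenerated.
Variable A : pzRingType.
Implicit Types M N X Y Z : lmodType A.

Lemma fg_image M N (p : {linear M -> N}) :
  surjective p -> finitely_generated M -> finitely_generated N.
Proof.
move=> p_surj [n [v v_gen]]; exists n, (p \o v) => y.
have [x <-] := p_surj y; have [c ->] := v_gen x; exists c.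
by rewrite linear_sum; apply: eq_bigr => i _; rewrite linearZ.
Qed.

Lemma fg_quotient (M : fgmod A) (K : M -> Prop) :
    K 0 -> (forall a x y, K x -> K y -> K (a *: x + y)) ->
  exists (Q : fgmod A) (p : {linear M -> Q}),
    surjective p /\ forall x, p x = 0 <-> K x.
Proof.
move=> K0 KL; have [Q [p [p_surj pK]]] := quotient_exists K0 KL.
by exists (FgMod (fg_image p_surj (fgmodP M))), p.
Qed.

Lemma fg_cokernel X (Y : fgmod A) (f : {linear X -> Y}) :
  exists (Q : fgmod A) (p : {linear Y -> Q}),
    surjective p /\ exact_at f p.
Proof.
apply: (@fg_quotient Y (fun y => exists x, f x = y)).
  by exists 0; rewrite linear0.
by move=> a _ _ [x <-] [y <-]; exists (a *: x + y); rewrite linearP.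
Qed.

(** The image is built as the quotient of the source by the kernel, so it is
    finitely generated over any ring, noetherian or not. *)
Lemma fg_image_factor (X : fgmod A) Y (f : {linear X -> Y}) :
  exists (C : fgmod A) (p : {linear X -> C}) (i : {linear C -> Y}),
    [/\ surjective p, injective i & forall x, i (p x) = f x].
Proof.
have [||C [p [p_surj pK]]] := @fg_quotient X (fun x => f x = 0).
- exact: linear0.
- by move=> a x y fx fy; rewrite linearP fx fy scaler0 addr0.
have [i ip] := descend p_surj (fun x => (pK x).1).
exists C, p, i; split=> //; apply: linear_inj => c.
by have [x <-] := p_surj c; rewrite ip => /pK.
Qed.

End FinitelyGenerated.

Section Powers.
Variable A : pzRingType.
Implicit Types M N X Y Z : lmodType A.

Definition pow_coord n M (i : 'I_n) : {linear {ffun 'I_n -> M} -> M}.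
Proof.
apply: (@linear_map A _ _ (fun v : {ffun 'I_n -> M} => v i)).
by move=> a v w; rewrite !ffunE.
Defined.

Definition pow_inj n M (i : 'I_n) : {linear M -> {ffun 'I_n -> M}}.
Proof.
apply: (@linear_map A _ _ (fun x => [ffun j => if j == i then x else 0])).
move=> a x y; apply/ffunP => j; rewrite !ffunE.
by case: eqP; rewrite // scaler0 addr0.
Defined.

Arguments pow_coord {n M} i.
Arguments pow_inj {n M} i.

Definition copair n M N (h : 'I_n -> {linear M -> N}) :
  {linear {ffun 'I_n -> M} -> N}.
Proof.
apply: (@linear_map A _ _ (fun v : {ffun 'I_n -> M} => \sum_i h i (v i))).
move=> a v w; rewrite scaler_sumr -big_split; apply: eq_bigr => i _.
by rewrite !ffunE linearP.
Defined.

Definition tupling n M N (h : 'I_n -> {linear M -> N}) :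
  {linear M -> {ffun 'I_n -> N}}.
Proof.
apply: (@linear_map A _ _ (fun x => [ffun i => h i x])).
by move=> a x y; apply/ffunP => i; rewrite !ffunE linearP.
Defined.

Definition pow_map n M N (h : {linear M -> N}) :
    {linear {ffun 'I_n -> M} -> {ffun 'I_n -> N}} :=
  tupling (fun i => h \o pow_coord i).

Lemma pow_mapE n M N (h : {linear M -> N}) (v : {ffun 'I_n -> M}) i :
  pow_map n h v i = h (v i).
Proof. by rewrite ffunE. Qed.

Lemma pow_decomp n M (v : {ffun 'I_n -> M}) : v = \sum_i pow_inj i (v i).
Proof.
apply/ffunP => j; rewrite sum_ffunE (bigD1 j) //= ffunE eqxx big1 ?addr0 //.
by move=> i ij; rewrite ffunE eq_sym (negPf ij).
Qed.

Lemma pow_hom_eq n M N (f : {linear {ffun 'I_n -> M} -> N}) v :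
  f v = \sum_i f (pow_inj i (v i)).
Proof. by rewrite [v in LHS]pow_decomp linear_sum. Qed.

Lemma fg_pow n (M : fgmod A) :
  finitely_generated ({ffun 'I_n -> M} : lmodType A).
Proof.
have [m [v v_gen]] := fgmodP M.
exists #|{: 'I_n * 'I_m}|,
  (fun k => pow_inj (enum_val k).1 (v (enum_val k).2)) => x.
have /choice[c cE] (i : 'I_n) := v_gen (x i).
exists (fun k => c (enum_val k).1 (enum_val k).2).
rewrite -(big_enum_val (fun k : 'I_n * 'I_m =>
  c k.1 k.2 *: pow_inj k.1 (v k.2))).
rewrite -(pair_bigA _ (fun i j => c i j *: pow_inj i (v j))) /=.
rewrite [LHS]pow_decomp; apply: eq_bigr => i _; rewrite cE linear_sum.
by apply: eq_bigr => j _; rewrite linearZ.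
Qed.

Definition pow n (M : fgmod A) : fgmod A := FgMod (fg_pow n M).

Definition combination n M (v : 'I_n -> M) :
  {linear {ffun 'I_n -> A^o} -> M}.
Proof.
refine (@linear_map A _ _
  (fun c : {ffun 'I_n -> A^o} => \sum_i (c i : A) *: v i) _).
move=> a c d; rewrite scaler_sumr -big_split; apply: eq_bigr => i _.
by rewrite !ffunE scalerDl scalerA.
Defined.

Lemma combination_surj n M (v : 'I_n -> M) :
    (forall x, exists c : 'I_n -> A, x = \sum_(i < n) c i *: v i) ->
  surjective (combination v).
Proof.
move=> v_gen x; have [c ->] := v_gen x; exists [ffun i => c i] => /=.
by apply: eq_bigr => i _; rewrite ffunE.
Qed.

Definition elt M (x : M) : {linear regmod A -> M}.
Proof.
refine (@linear_map A (regmod A) _ (fun a : A => a *: x) _).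
by move=> a b c; rewrite scalerDl scalerA.
Defined.

Lemma elt1 M (x : M) : elt x (1 : A) = x.
Proof. exact: scale1r. Qed.

Lemma regmod_hom M (f : {linear regmod A -> M}) (a : A) :
  f a = a *: f (1 : A).
Proof. by rewrite -linearZ /= -[in LHS](mulr1 a). Qed.

End Powers.

Arguments pow_coord {A n M} i.
Arguments pow_inj {A n M} i.

(** * Projective presentations and the vanishing of extensions *)

Section Projectives.
Variable A : pzRingType.
Implicit Types P Q : fgmod A.

Lemma projective_dual_basis P : projective P ->
  exists n (v : 'I_n -> P) (s : {linear P -> {ffun 'I_n -> A^o}}),
    forall x, combination v (s x) = x.
Proof.
move=> P_proj; have [n [v v_gen]] := fgmodP P.
have [s sK] := P_proj (pow n (regmod A)) _ (combination v) idfun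
  (combination_surj v_gen).
by exists n, v, s.
Qed.

(** [projective] only speaks of finitely generated targets; the dual basis
    frees the lifting property from this restriction, and from the
    surjectivity of [g] beyond the image of [h]. *)
Lemma projective_lift P (X Y : lmodType A)
    (g : {linear X -> Y}) (h : {linear P -> Y}) :
    projective P -> (forall x, exists u, g u = h x) ->
  exists k : {linear P -> X}, forall x, g (k x) = h x.
Proof.
move=> /projective_dual_basis[n [v [s sK]]] im.
have /choice[u uE] (i : 'I_n) := im (v i).
exists (combination u \o s) => x; rewrite -[in RHS](sK x) /= !linear_sum.
by apply: eq_bigr => i _; rewrite !linearZ /= uE.
Qed.

Lemma regular_projective : projective (regmod A).
Proof.
move=> M N g h g_surj; have [u uE] := g_surj (h (1 : A)).
by exists (elt u) => a; rewrite [RHS]regmod_hom -uE -linearZ.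
Qed.

Lemma pow_projective n P : projective P -> projective (pow n P).
Proof.
move=> P_proj M N g h g_surj.
have /choice[k kE] (i : 'I_n) :=
  P_proj M N g (h \o pow_inj i : {linear P -> N}) g_surj.
exists (copair k) => x; rewrite [RHS]pow_hom_eq linear_sum.
by apply: eq_bigr => i _; rewrite kE.
Qed.

Lemma pow0_zero (M : lmodType A) : zero_module ({ffun 'I_0 -> M} : lmodType A).
Proof. by move=> v; apply/ffunP => -[]. Qed.

Definition dsum_inl (M N : lmodType A) : {linear M -> (M * N)%type}.
Proof.
apply: (@linear_map A _ (M * N)%type (fun x => (x, 0))) => a x y.
by apply/eqP; rewrite xpair_eqE /= scaler0 addr0 !eqxx.
Defined.

Definition dsum_inr (M N : lmodType A) : {linear N -> (M * N)%type}.
Proof.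
apply: (@linear_map A _ (M * N)%type (fun x => (0, x))) => a x y.
by apply/eqP; rewrite xpair_eqE /= scaler0 addr0 !eqxx.
Defined.

Definition dsum_copair (M N X : lmodType A)
    (f : {linear M -> X}) (g : {linear N -> X}) : {linear (M * N)%type -> X} :=
  (f \o (fst : {linear (M * N)%type -> M})) \+
  (g \o (snd : {linear (M * N)%type -> N})).

Definition dsum_pair (M N X : lmodType A)
  (f : {linear X -> M}) (g : {linear X -> N}) : {linear X -> (M * N)%type}.
Proof.
apply: (@linear_map A _ (M * N)%type (fun x => (f x, g x))) => a x y.
by apply/eqP; rewrite xpair_eqE /= !linearP !eqxx.
Defined.

Lemma dsum_hom_eq (M N X : lmodType A) (f : {linear (M * N)%type -> X}) x :
  f x = f (dsum_inl M N x.1) + f (dsum_inr M N x.2).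
Proof.
rewrite -linearD; congr (f _); case: x => x y; apply/eqP.
by rewrite xpair_eqE /= addr0 add0r !eqxx.
Qed.

Lemma dsum_projective P Q :
  projective P -> projective Q -> projective (dsum P Q).
Proof.
move=> P_proj Q_proj M N g h g_surj.
have [k kE] := P_proj M N g (h \o dsum_inl P Q : {linear P -> N}) g_surj.
have [l lE] := Q_proj M N g (h \o dsum_inr P Q : {linear Q -> N}) g_surj.
by exists (dsum_copair k l) => x; rewrite /= linearD kE lE -dsum_hom_eq.
Qed.

End Projectives.

Section Presentations.
Variable A : pzRingType.
Implicit Types T Z W : fgmod A.

Record presentation Z := Presentation {
  pres1 : fgmod A;
  pres0 : fgmod A;
  pres_d : {linear pres1 -> pres0};
  pres_e : {linear pres0 -> Z};
  pres1_proj : projective pres1;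
  pres0_proj : projective pres0;
  pres_exact : short_exact pres_d pres_e }.

Arguments pres1_proj {Z} p.
Arguments pres0_proj {Z} p.
Arguments pres_exact {Z} p.

(** The cokernel of Hom(P0, X) -> Hom(P1, X) is Ext^1(Z, X). *)
Definition ext_vanishes Z (p : presentation Z) (X : lmodType A) : Prop :=
  forall f : {linear pres1 p -> X},
    exists g : {linear pres0 p -> X}, forall x, g (pres_d p x) = f x.

Section OnePresentation.
Variables (Z : fgmod A) (p : presentation Z).
Local Notation d := (pres_d p).
Local Notation e := (pres_e p).

Lemma pres_d_inj : injective d. Proof. by have [] := pres_exact p. Qed.
Lemma pres_e_surj : surjective e. Proof. by have [] := pres_exact p. Qed.
Lemma pres_ker y : e y = 0 -> exists x, d x = y.
Proof. by have [_ ex _] := pres_exact p; move/ex. Qed.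
Lemma pres_ed x : e (d x) = 0.
Proof. by have [_ ex _] := pres_exact p; apply/ex; exists x. Qed.

Lemma ext_vanishes_surj (X Y : lmodType A) (g : {linear X -> Y}) :
  surjective g -> ext_vanishes p X -> ext_vanishes p Y.
Proof.
move=> g_surj pX f.
have [f' f'E] := projective_lift (pres1_proj p) (fun x => g_surj (f x)).
by have [k kE] := pX f'; exists (g \o k) => x; rewrite /= kE f'E.
Qed.

Lemma ext_vanishes_pow n (X : lmodType A) :
  ext_vanishes p X -> ext_vanishes p ({ffun 'I_n -> X} : lmodType A).
Proof.
move=> pX f; have /choice[g gE] (i : 'I_n) := pX (pow_coord i \o f).
by exists (tupling g) => x; apply/ffunP => i; rewrite ffunE gE.
Qed.

Lemma ext_vanishes_dsum (X Y : lmodType A) :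
  ext_vanishes p X -> ext_vanishes p Y ->
  ext_vanishes p ((X * Y)%type : lmodType A).
Proof.
move=> pX pY f.
have [g gE] := pX ((fst : {linear (X * Y)%type -> X}) \o f).
have [h hE] := pY ((snd : {linear (X * Y)%type -> Y}) \o f).
by exists (dsum_pair g h) => x; rewrite /= gE hE /= -surjective_pairing.
Qed.

(** Part of the long exact sequence of Hom(Z, -): if Ext^1(Z, Y) = 0 then
    Ext^1(Z, E) is the image of Ext^1(Z, X), here supposed to vanish. *)
Lemma ext_vanishes_middle (X E Y : lmodType A)
    (i : {linear X -> E}) (q : {linear E -> Y}) :
    short_exact i q ->
    (forall u : {linear pres1 p -> X},
       exists g : {linear pres0 p -> E}, forall x, g (d x) = i (u x)) ->
    ext_vanishes p Y ->
  ext_vanishes p E.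
Proof.
move=> [i_inj ex q_surj] pX pY f.
have [w wE] := pY (q \o f).
have [w' w'E] := projective_lift (pres0_proj p) (fun x => q_surj (w x)).
have im x : exists u, i u = (f \- (w' \o d)) x.
  by apply/ex; rewrite /= linearB w'E wE subrr.
have [u uE] := corestrict i_inj im.
have [g gE] := pX u; exists (w' \+ g) => x.
by rewrite /= gE uE /= addrC subrK.
Qed.

(** Ext^1 computed from [p] controls all extensions by retracts Z' of Z.  The
    map [f] need not be injective, so that the lemma also applies to the
    first syzygy of an arbitrary projective resolution. *)
Lemma extend_along (Z' U V X : lmodType A)
    (f : {linear U -> V}) (g : {linear V -> Z'})
    (s : {linear Z' -> Z}) (r : {linear Z -> Z'}) (u : {linear U -> X}) :
    (forall x, r (s x) = x) -> exact_at f g -> surjective g ->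
    (forall x, f x = 0 -> u x = 0) -> ext_vanishes p X ->
  exists v : {linear V -> X}, forall x, v (f x) = u x.
Proof.
move=> rs ex g_surj u_ker pX.
have [a aE] := projective_lift (h := r \o e) (pres0_proj p)
  (fun x => g_surj (r (e x))).
have im x : exists w, f w = (a \o d) x.
  by apply/ex; rewrite /= aE /= pres_ed linear0.
have [c cE] := projective_lift (pres1_proj p) im.
have [h hE] := pX (u \o c).
pose G y t := exists z w, [/\ e z = s (g y), y = f w + a z & t = u w + h z].
have [|||v vG] := @linear_of_graph _ _ _ G.
- move=> y; have [z ez] := pres_e_surj (s (g y)).
  have [w fw] : exists w, f w = y - a z.
    by apply/ex; rewrite linearB aE /= ez rs subrr.
  by exists (u w + h z), z, w; rewrite fw subrK.
- move=> b y t y' t' [z [w [ez yE tE]]] [z' [w' [ez' yE' tE']]].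
  exists (b *: z + z'), (b *: w + w'); rewrite !linearP ez ez' yE yE' tE tE'.
  by split=> //; rewrite scalerDr addrACA.
- move=> t [z [w [ez yE ->]]]; rewrite !linear0 in ez.
  have [q dq] := pres_ker ez.
  have: u (w + c q) = 0 by apply: u_ker; rewrite linearD cE /= dq.
  by rewrite linearD -dq hE.
exists v => x; apply: vG; exists 0, x.
by rewrite !linear0 !addr0; split=> //; rewrite (ex _).2 ?linear0 //; exists x.
Qed.

Lemma ext1_zero_of_vanishes (N : fgmod A) : ext_vanishes p N -> ext1_zero Z N.
Proof.
move=> pN Q f f_cocycle.
have [|v vE] := @extend_along _ _ _ _ (res_diff Q 0%N) (res_aug Q) idfun idfun f
  (fun=> erefl) (@res_exact0 _ _ Q) (@res_aug_surj _ _ Q) _ pN.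
  by move=> x /(@res_exact _ _ Q 0%N)[y <-].
by exists v => x; rewrite vE.
Qed.

Definition res_of_pres_obj n : fgmod A :=
  match n with 0%N => pres0 p | 1%N => pres1 p | _ => pow 0 (regmod A) end.

Definition res_of_pres_diff n :
    {linear res_of_pres_obj n.+1 -> res_of_pres_obj n} :=
  match n with 0%N => d | _.+1 => \0 end.

Lemma pd_le_of_pres : pd_le Z 1.
Proof.
have zero n : zero_module (res_of_pres_obj n.+2) by apply: pow0_zero.
have [P PE] : exists P : proj_resolution Z, res_obj P = res_of_pres_obj.
  unshelve eexists (@ProjResolution _ _ res_of_pres_obj res_of_pres_diff e
    _ pres_e_surj _ _) => //.
  - case=> [|[|n]]; [exact: pres0_proj | exact: pres1_proj |].
    by move=> M N g h _; exists \0 => x; rewrite linear0 (zero n x) linear0.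
  - by have [_] := pres_exact p.
  case=> [|n] y; split.
  - by move=> /= dy; exists 0; apply: pres_d_inj; rewrite dy !linear0.
  - by move=> [x <-]; rewrite /= linear0.
  - by move=> _; exists 0; rewrite (zero n y) linear0.
  - by move=> _.
by exists P => -[|[|i]] // _; rewrite PE; apply: zero.
Qed.

End OnePresentation.

Lemma pres_of_pd_le Z : pd_le Z 1 ->
  exists p : presentation Z,
    forall X : fgmod A, ext1_zero Z X -> ext_vanishes p X.
Proof.
case=> P zero.
have ses : short_exact (res_diff P 0%N) (res_aug P).
  split; [|exact: res_exact0|exact: res_aug_surj].
  apply: linear_inj => x /(@res_exact _ _ P 0%N)[y <-].
  by rewrite (zero 2%N isT y) linear0.
exists (Presentation (@res_proj _ _ P 1%N) (@res_proj _ _ P 0%N) ses).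
move=> X ext f.
have [|g gE] := ext P f; first by move=> x; rewrite (zero 2%N isT x) !linear0.
by exists g => x; rewrite gE.
Qed.

Arguments pres_d_inj {Z} p.
Arguments pres_e_surj {Z} p.

Section PowerPresentation.
Variables (n : nat) (Z : fgmod A) (p : presentation Z).

Lemma pow_short_exact :
  short_exact (pow_map n (pres_d p)) (pow_map n (pres_e p)).
Proof.
split=> [|v|v].
- apply: linear_inj => v dv; apply/ffunP => i.
  apply: (pres_d_inj p); rewrite -[LHS]pow_mapE dv !ffunE.
  by rewrite linear0.
- split=> [ev|[w <-]]; last first.
    by apply/ffunP => i; rewrite !pow_mapE pres_ed ffunE.
  have /choice[w wE] i : exists x, pres_d p x = v i.
    by apply: pres_ker; rewrite -pow_mapE ev ffunE.
  by exists [ffun i => w i]; apply/ffunP => i; rewrite !ffunE /= ffunE wE.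
have /choice[w wE] i := pres_e_surj p (v i).
by exists [ffun i => w i]; apply/ffunP => i; rewrite !ffunE /= ffunE wE.
Qed.

Definition pow_presentation : presentation (pow n Z) :=
  @Presentation (pow n Z) (pow n (pres1 p)) (pow n (pres0 p)) _ _
    (pow_projective (pres1_proj p)) (pow_projective (pres0_proj p))
    pow_short_exact.

Lemma pow_ext_vanishes (X : lmodType A) :
  ext_vanishes p X -> ext_vanishes pow_presentation X.
Proof.
move=> pX f; have /choice[g gE] (i : 'I_n) := pX (f \o pow_inj i).
exists (copair g) => x; rewrite [RHS]pow_hom_eq.
by apply: eq_bigr => i _; rewrite pow_mapE gE.
Qed.

End PowerPresentation.

End Presentations.

Arguments pres1_proj {A Z} p.
Arguments pres0_proj {A Z} p.
Arguments pres_exact {A Z} p.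
Arguments pres_d_inj {A Z} p.
Arguments pres_e_surj {A Z} p.

(** * Summands of powers and torsion quotients *)

Section AddClosure.
Variables (A : pzRingType) (T : fgmod A).
Implicit Types M X : fgmod A.

Lemma in_add_of_retract n M (s : {linear M -> {ffun 'I_n -> T}})
    (r : {linear {ffun 'I_n -> T} -> M}) :
  (forall x, r (s x) = x) -> in_add T M.
Proof.
move=> rs; have [N [p [p_surj ex]]] := @fg_cokernel A M (pow n T) s.
exists n, N; apply: isomorphic_sym.
apply: (@isomorphic_of_inj_surj _ _ _ (dsum_pair r p)).
  apply: linear_inj => v /eqP; rewrite xpair_eqE.
  move=> /andP[/eqP rv /eqP /ex[x sx]].
  by rewrite -sx -(rs x) sx rv linear0.
move=> [x y]; have [v <-] := p_surj y.
exists (v - s (r v) + s x); apply/eqP; rewrite xpair_eqE /=.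
rewrite !linearD !linearN !rs /= subrr add0r eqxx /=.
have ps z : p (s z) = 0 by apply/ex; exists z.
by rewrite !ps subr0 addr0.
Qed.

(** Two factorizations through powers of T add up to one through a larger
    power: the endomorphisms factoring through add T form an ideal. *)
Lemma in_add_of_sum m n M
    (s : {linear M -> {ffun 'I_m -> T}}) (r : {linear {ffun 'I_m -> T} -> M})
    (s' : {linear M -> {ffun 'I_n -> T}})
    (r' : {linear {ffun 'I_n -> T} -> M}) :
  (forall x, r (s x) + r' (s' x) = x) -> in_add T M.
Proof.
move=> sum1.
pose c (i : 'I_(m + n)) : {linear M -> T} := match split i with
  inl j => pow_coord j \o s | inr k => pow_coord k \o s' end.
pose h (i : 'I_(m + n)) : {linear T -> M} := match split i with
  inl j => r \o pow_inj j | inr k => r' \o pow_inj k end.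
apply: (@in_add_of_retract _ M (tupling c) (copair h)) => x.
rewrite -[RHS]sum1 /= big_split_ord; congr (_ + _); rewrite [RHS]pow_hom_eq;
  apply: eq_bigr => i _; rewrite ffunE /c /h.
  by rewrite (unsplitK (inl i)).
by rewrite (unsplitK (inr i)).
Qed.

Lemma in_add_pow n : in_add T (pow n T).
Proof. exact: (@in_add_of_retract n (pow n T) idfun idfun). Qed.

Lemma in_add_retract M : in_add T M ->
  exists n (s : {linear M -> pow n T}) (r : {linear pow n T -> M}),
    forall x, r (s x) = x.
Proof.
move=> [n [N [f f_bij]]].
have [g [g' gK g'K]] := isomorphic_sym (ex_intro _ f f_bij).
have [f' fK f'K] := f_bij.
have f_inj : injective f := can_inj fK.
have [k kK] : exists k : {linear {ffun 'I_n -> T} -> (M * N)%type},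
    forall x, f (k x) = idfun x.
  by apply: corestrict => // x; exists (f' x); rewrite f'K.
exists n, (f \o dsum_inl M N),
  ((fst : {linear (M * N)%type -> M}) \o k) => x /=.
by have -> : k (f (x, 0)) = (x, 0) by apply: f_inj; rewrite kK.
Qed.

Lemma perp0_pow n X (f : {linear {ffun 'I_n -> T} -> X}) v :
  perp0 T X -> f v = 0.
Proof.
by move=> TX; rewrite pow_hom_eq big1 // => i _; apply: (TX (f \o pow_inj i)).
Qed.

Lemma perp0_in_add X M (f : {linear M -> X}) x :
  in_add T M -> perp0 T X -> f x = 0.
Proof.
move=> /in_add_retract[n [s [r rs]]] TX.
by rewrite -(rs x); apply: (@perp0_pow _ _ (f \o r)).
Qed.

Lemma gen_perp0 M X (f : {linear M -> X}) x : Gen T M -> perp0 T X -> f x = 0.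
Proof.
move=> [n [p p_surj]] TX; have [v <-] := p_surj x.
exact: (@perp0_pow _ _ (f \o p)).
Qed.

End AddClosure.

Section Trace.
Variables (A : pzRingType) (T : fgmod A).
Implicit Types M X : fgmod A.

Definition in_trace M (x : M) : Prop :=
  exists n (f : {linear {ffun 'I_n -> T} -> M}) v, f v = x.

Lemma join_pow m n M (f : {linear {ffun 'I_m -> T} -> M})
    (g : {linear {ffun 'I_n -> T} -> M}) :
  exists h : {linear {ffun 'I_(m + n) -> T} -> M},
    forall v w, exists u, h u = f v + g w.
Proof.
pose c (i : 'I_(m + n)) : {linear T -> M} := match split i with
  inl j => f \o pow_inj j | inr k => g \o pow_inj k end.
exists (copair c) => v w; exists [ffun i => match split i with
  inl j => v j | inr k => w k end] => /=.
rewrite big_split_ord /= !(@pow_hom_eq _ _ _ M).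
congr (_ + _); apply: eq_bigr => i _; rewrite ffunE /c.
  by rewrite (unsplitK (inl i)).
by rewrite (unsplitK (inr i)).
Qed.

Lemma in_trace_linear M a (x y : M) :
  in_trace x -> in_trace y -> in_trace (a *: x + y).
Proof.
move=> [m [f [v <-]]] [n [g [w <-]]]; have [h hE] := join_pow f g.
by have [u uE] := hE (a *: v) w; exists (m + n)%N, h, u; rewrite uE linearZ.
Qed.

Lemma in_trace0 M : in_trace (0 : M).
Proof. by exists 0%N, \0, 0. Qed.

Lemma in_trace_hom M (f : {linear T -> M}) x : in_trace (f x).
Proof.
exists 1%N, (copair (fun=> f)), [ffun=> x].
by rewrite /= big_ord1 ffunE.
Qed.

Lemma in_trace_uniform M n (v : 'I_n -> M) : (forall i, in_trace (v i)) ->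
  exists k (h : {linear {ffun 'I_k -> T} -> M}), forall i, exists w, h w = v i.
Proof.
elim: n v => [|n IHn] v v_tr.
  by exists 0%N, \0 => -[].
have [k [h hE]] := IHn _ (fun i => v_tr (lift ord0 i)).
have [m [f [w0 fw0]]] := v_tr ord0; have [g gE] := join_pow f h.
exists (m + k)%N, g => i; have [j ->|->] := unliftP ord0 i.
  have [w <-] := hE j; have [u uE] := gE 0 w.
  by exists u; rewrite uE linear0 add0r.
by have [u uE] := gE w0 0; exists u; rewrite uE linear0 addr0.
Qed.

Lemma gen_of_trace M : (forall x : M, in_trace x) -> Gen T M.
Proof.
move=> tr; have [n [v v_gen]] := fgmodP M.
have [k [h hE]] := in_trace_uniform (fun i => tr (v i)).
exists k, h => x; have [c ->] := v_gen x; have /choice[w wE] := hE.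
exists (\sum_i c i *: w i); rewrite linear_sum.
by apply: eq_bigr => i _; rewrite linearZ wE.
Qed.

(** When Ext^1(T, T) = 0, the torsion part of M is the trace of T.  A map from
    T to the quotient lifts on P0, and what obstructs a lift on T is a map from
    P1 to the trace; as P1 is finitely generated and projective, it factors
    through one power of T and hence extends to P0. *)
Lemma torsion_quotient (p : presentation T) M : ext_vanishes p T ->
  exists (X : fgmod A) (q : {linear M -> X}),
    [/\ surjective q, perp0 T X & zero_module X -> Gen T M].
Proof.
move=> pT; have [X [q [q_surj qK]]] :=
  @fg_quotient A M (@in_trace M) (in_trace0 M) (@in_trace_linear M).
exists X, q; split=> // [g x|X0]; last first.
  by apply: gen_of_trace => x; apply/qK; apply: X0.
have [k kE] := projective_lift (h := g \o pres_e p) (pres0_proj p)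
  (fun z => q_surj (g (pres_e p z))).
have [n [v v_gen]] := fgmodP (pres1 p).
have [|m [h hE]] := @in_trace_uniform M n (k \o pres_d p \o v).
  by move=> i; apply/qK; rewrite /= kE /= pres_ed linear0.
have im z : exists w, h w = (k \o pres_d p) z.
  have /choice[w wE] := hE; have [c ->] := v_gen z.
  exists (\sum_i c i *: w i); rewrite !linear_sum.
  by apply: eq_bigr => i _; rewrite !linearZ wE.
have [l lE] := projective_lift (pres1_proj p) im.
have [b bE] := ext_vanishes_pow pT l.
have [|t tE] := @descend _ _ _ _ (pres_e p) (k \- (h \o b)) (pres_e_surj p).
  by move=> y /pres_ker[z <-]; rewrite /= bE lE /= subrr.
have [z zE] := pres_e_surj p x; rewrite -zE -[LHS]kE.
have -> : k z = t x + h (b z) by rewrite -zE tE /= subrK.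
apply/qK; rewrite -[t x]scale1r; apply: in_trace_linear.
  exact: in_trace_hom.
by exists m, h, (b z).
Qed.

(** The projection of M to its torsion-free quotient is itself one of the maps
    supposed to vanish. *)
Lemma gen_of_left_orthogonal (p : presentation T) M : ext_vanishes p T ->
    (forall (X : fgmod A) (f : {linear M -> X}),
       surjective f -> perp0 T X -> forall x, f x = 0) ->
  Gen T M.
Proof.
move=> pT orth; have [X [q [q_surj TX X0]]] := torsion_quotient M pT.
by apply: X0 => y; have [x <-] := q_surj y; apply: orth.
Qed.

End Trace.

(** * Extensions as pushouts *)

Section Pushout.
Variables (A : pzRingType) (Z : fgmod A) (p : presentation Z).
Local Notation d := (pres_d p).
Local Notation e := (pres_e p).

(** The extension 0 -> N -> E -> Z -> 0 whose class in Ext^1(Z, N) is that of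
    [f : P1 -> N], with the maps that make it the pushout of P1 -> P0 along f.
    That it is the pushout follows from exactness, see [extension_univ]. *)
Record extension (N : fgmod A) (f : {linear pres1 p -> N}) := Extension {
  ext_obj : fgmod A;
  ext_i : {linear N -> ext_obj};
  ext_b : {linear pres0 p -> ext_obj};
  ext_q : {linear ext_obj -> Z};
  ext_exact : short_exact ext_i ext_q;
  ext_square : forall x, ext_i (f x) = ext_b (d x);
  ext_qb : forall y, ext_q (ext_b y) = e y }.

Lemma extension_exists (N : fgmod A) (f : {linear pres1 p -> N}) :
  inhabited (extension f).
Proof.
have [E [c [c_surj ex]]] :=
  @fg_cokernel A _ (dsum N (pres0 p)) (dsum_pair f (-%R \o d)).
pose i := c \o dsum_inl N (pres0 p); pose b := c \o dsum_inr N (pres0 p).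
have cE n y : c (n, y) = i n + b y := @dsum_hom_eq _ _ _ _ c (n, y).
have square x : i (f x) = b (d x).
  apply/subr0_eq; rewrite -linearN -cE; apply/ex; by exists x.
have [|q qE] := @descend _ _ _ _ c
    (e \o (snd : {linear (N * pres0 p)%type -> pres0 p})) c_surj.
  by move=> y /ex[x <-]; rewrite /= linearN pres_ed oppr0.
have qi n : q (i n) = 0 by rewrite qE /= linear0.
have qb y : q (b y) = e y by rewrite qE.
suff ses : short_exact i q by exists; apply: (Extension ses square qb).
split=> [|y|z].
- apply: linear_inj => n /ex[x] /eqP; rewrite xpair_eqE => /andP[/eqP <- /eqP].
  move=> /eqP; rewrite oppr_eq0 => /eqP dx.
  by rewrite (@pres_d_inj _ _ p x 0) ?linear0.
- split=> [|[n <-] //]; have [[n z] <-] := c_surj y.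
  rewrite cE linearD qi qb add0r => /pres_ker[x <-].
  by exists (n + f x); rewrite -square; apply: linearD.
by have [y <-] := pres_e_surj p z; exists (b y).
Qed.

Lemma extension_univ (N : fgmod A) (f : {linear pres1 p -> N}) (E : extension f)
    (X : lmodType A) (a : {linear N -> X}) (b : {linear pres0 p -> X}) :
    (forall x, a (f x) = b (d x)) ->
  exists t : {linear ext_obj E -> X},
    (forall n, t (ext_i E n) = a n) /\ (forall y, t (ext_b E y) = b y).
Proof.
move=> ab; have [i_inj ex q_surj] := ext_exact E.
have qi n : ext_q E (ext_i E n) = 0 by apply/ex; exists n.
pose G y t := exists n z, y = ext_i E n + ext_b E z /\ t = a n + b z.
have [|||t tG] := @linear_of_graph _ _ _ G.
- move=> y; have [z ez] := pres_e_surj p (ext_q E y).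
  have [n nE] : exists n, ext_i E n = y - ext_b E z.
    by apply/ex; rewrite linearB ext_qb ez subrr.
  by exists (a n + b z), n, z; rewrite nE subrK.
- move=> c y t y' t' [n [z [-> ->]]] [n' [z' [-> ->]]].
  exists (c *: n + n'), (c *: z + z'); rewrite !linearP !scalerDr.
  by split; apply: addrACA.
- move=> t [n [z [yE ->]]].
  have /pres_ker[x xz] : e z = 0.
    by rewrite -(ext_qb E) -[LHS]add0r -{1}(qi n) -linearD -yE linear0.
  rewrite -xz -ext_square -linearD in yE.
  by rewrite -xz -ab -linearD (i_inj (n + f x) 0) ?linear0.
exists t; split=> [n|y]; apply: tG.
  by exists n, 0; rewrite !linear0 !addr0.
by exists 0, y; rewrite !linear0 !add0r.
Qed.

End Pushout.

(** The horseshoe: presentations of N and Z give one of the extension E.  With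
    [c : P1 -> Q0] a lift of the class f, the differential is the block matrix
    (d, -c; 0, d), so that a map (a, u) on Q1 + P1 extends as soon as a does, by
    a', and u + a' c does.  The three conclusions read off from this the pieces
    of the long exact sequence of Hom(-, X) used below. *)
Lemma horseshoe (A : pzRingType) (N Z : fgmod A) (pN : presentation N)
    (p : presentation Z) (f : {linear pres1 p -> N}) (E : extension f) :
  exists pE : presentation (ext_obj E), forall X : lmodType A,
    [/\ ext_vanishes pN X -> ext_vanishes p X -> ext_vanishes pE X,
        ext_vanishes pN X ->
          (forall u : {linear pres1 p -> X}, exists (a : {linear N -> X}),
             forall x, a (f x) = u x) ->
          ext_vanishes pE X
      & ext_vanishes pE X -> (forall (g : {linear N -> X}) x, g x = 0) ->
          ext_vanishes p X].
Proof.
have [i_inj ex q_surj] := ext_exact E.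
have [c cE] := projective_lift (pres1_proj p) (fun x => pres_e_surj pN (f x)).
pose D : {linear (pres1 pN * pres1 p)%type -> (pres0 pN * pres0 p)%type} :=
  dsum_copair (dsum_inl _ _ \o pres_d pN)
              (dsum_pair (-%R \o c) (pres_d p)).
pose e := dsum_copair (ext_i E \o pres_e pN) (ext_b E).
have DE x : D x = (pres_d pN x.1 - c x.2, pres_d p x.2).
  by apply/eqP; rewrite /D xpair_eqE /= add0r !eqxx.
have ses : short_exact D e.
  split=> [|y|z].
  - apply: linear_inj => -[x y] /(etrans (esym (DE _)))/eqP.
    rewrite xpair_eqE /=.
    move=> /andP[/eqP + /eqP dy]; have -> : y = 0.
      by apply: (pres_d_inj p); rewrite dy linear0.
    rewrite linear0 subr0 => dx; have -> // : x = 0.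
    by apply: (pres_d_inj pN); rewrite dx linear0.
  - split=> [|[x <-]]; last first.
      rewrite DE /= linearB pres_ed add0r cE linearN.
      by rewrite ext_square addNr.
    case: y => y z /= yz.
    have /pres_ker[x xz] : pres_e p z = 0.
      rewrite -(ext_qb E); have /eqP := yz; rewrite addrC addr_eq0 => /eqP ->.
      by rewrite linearN (ex _).2 ?oppr0 //; eexists.
    have /pres_ker[w wE] : pres_e pN (y + c x) = 0.
      by apply: i_inj; rewrite linearD cE linearD ext_square xz yz linear0.
    by exists (w, x); apply: etrans (DE _) _; rewrite /= wE addrK xz.
  have [y yE] := pres_e_surj p (ext_q E z).
  have [n nE] : exists n, ext_i E n = z - ext_b E y.
    by apply/ex; rewrite linearB ext_qb yE subrr.
  have [x xE] := pres_e_surj pN n.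
  by exists (x, y); rewrite /= xE nE subrK.
exists (@Presentation _ (ext_obj E) (dsum (pres1 pN) (pres1 p))
  (dsum (pres0 pN) (pres0 p)) D e
  (dsum_projective (pres1_proj pN) (pres1_proj p))
  (dsum_projective (pres0_proj pN) (pres0_proj p)) ses) => X.
have key (g : {linear (pres1 pN * pres1 p)%type -> X})
      (a' : {linear pres0 pN -> X}) (b' : {linear pres0 p -> X}) :
    (forall x, a' (pres_d pN x) = g (dsum_inl _ _ x)) ->
    (forall x, b' (pres_d p x) = g (dsum_inr _ _ x) + a' (c x)) ->
  exists h : {linear (pres0 pN * pres0 p)%type -> X}, forall x, h (D x) = g x.
  move=> a'E b'E; exists (dsum_copair a' b') => x.
  rewrite DE /= linearB a'E b'E [RHS]dsum_hom_eq.
  by rewrite [_ + a' _]addrC addrA subrK.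
split=> [XN Xp g|XN Xf g|XE X0 u] /=.
- have [a' a'E] := XN (g \o dsum_inl _ _).
  have [b' b'E] := Xp ((g \o dsum_inr _ _) \+ (a' \o c)).
  exact: (key g a' b').
- have [a' a'E] := XN (g \o dsum_inl _ _).
  have [a aE] := Xf ((g \o dsum_inr _ _) \+ (a' \o c)).
  apply: (key g (a' \- (a \o pres_e pN)) \0) => x /=.
    by rewrite a'E pres_ed linear0 subr0.
  by rewrite cE aE /= addrA subrr.
have [h hE] := XE (u \o snd).
pose a : {linear pres0 pN -> X} := h \o dsum_inl _ _.
have hDE x y :
  h (D (x, y)) = a (pres_d pN x) - a (c y) + h (dsum_inr _ _ (pres_d p y)).
  by rewrite DE (dsum_hom_eq h) -linearB.
have a0 z : a z = 0.
  have [|g gE] := @descend _ _ _ _ (pres_e pN) a (pres_e_surj pN).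
    move=> y /pres_ker[x <-]; have := hE (x, 0).
    by rewrite hDE /= !linear0 !addr0.
  by rewrite -gE X0.
exists (h \o dsum_inr _ _) => y; have := hE (0, y).
by rewrite hDE !a0 subr0 add0r.
Qed.

(** * Tilting modules over algebras finite over their base *)

(** The use of the coresolution of the regular module: an element of X is a map
    from A, which extends to T0 because Ext^1(T1, X) = 0, and vanishes there. *)
Lemma tilting_generates (A : pzRingType) (T : fgmod A) : tilting T ->
  exists p : presentation T, ext_vanishes p T /\
    forall X : fgmod A, perp0 T X -> ext_vanishes p X -> zero_module X.
Proof.
move=> [/pres_of_pd_le[p pE] /pE pT [T0 [T1 [f [g [addT0 addT1 ses]]]]]].
exists p; split=> // X TX pX x; have [f_inj ex g_surj] := ses.
have [n [s [r rs]]] := in_add_retract addT1.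
have [|v vE] := extend_along (u := elt x) rs ex g_surj _
  (pow_ext_vanishes (n:=n) pX).
  by move=> a fa; rewrite (f_inj a 0) ?linear0.
by rewrite -(elt1 x) -vE (perp0_in_add _ _ addT0).
Qed.

Section FiniteAlgebra.
Variables (R : comPzRingType) (A : algType R).
Hypothesis A_fg : finitely_generated (A : lmodType R).

Definition central (M : lmodType A) (c : R) : {linear M -> M}.
Proof.
apply: (@linear_map A M M (fun x => c%:A *: x)) => a x y.
by rewrite scalerDr !scalerA mulr_algl mulr_algr.
Defined.

(** Hom(P, N) is a summand of a power of N, hence finitely generated over the
    base; the generators are products of the coordinates of P in a dual basis
    with generators of N. *)
Lemma hom_projective_fg (P N : fgmod A) : projective P ->
  exists n (f : 'I_n -> {linear P -> N}), forall u : {linear P -> N},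
    exists c : 'I_n -> R, forall x, u x = \sum_i central N (c i) (f i x).
Proof.
move=> /projective_dual_basis[m [v [s sK]]].
have [l [a a_gen]] := A_fg; have [k [w w_gen]] := fgmodP N.
pose F (j : 'I_m * ('I_l * 'I_k)) : {linear P -> N} :=
  elt (a j.2.1 *: w j.2.2) \o (pow_coord j.1 \o s).
exists #|{: 'I_m * ('I_l * 'I_k)}|, (fun i => F (enum_val i)) => u.
have /choice[b bE] (i : 'I_m) := w_gen (u (v i)).
have /choice[c cE] (ij : 'I_m * 'I_k) := a_gen (b ij.1 ij.2).
pose C (j : 'I_m * ('I_l * 'I_k)) := c (j.1, j.2.2) j.2.1.
exists (fun i => C (enum_val i)) => x.
rewrite -(big_enum_val (fun j => central N (C j) (F j x))) /=.
rewrite -(pair_bigA _ (fun i j => central N (C (i, j)) (F (i, j) x))) /=.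
rewrite -[in LHS](sK x) linear_sum; apply: eq_bigr => i _.
rewrite linearZ /= bE scaler_sumr.
rewrite -(pair_bigA _ (fun j h =>
  central N (C (i, (j, h))) (F (i, (j, h)) x))) /=.
rewrite exchange_big; apply: eq_bigr => h _.
rewrite (cE (i, h)) /= scaler_suml scaler_sumr; apply: eq_bigr => j _ /=.
by rewrite /C /= !scalerA mulr_algl -scalerAl -scalerAr.
Qed.

(** Bongartz's completion.  The universal extension 0 -> A -> E -> T^n -> 0
    kills Ext^1(T, E), so E is generated by T.  A lift of the image of 1 along a
    surjection T^k -> E extends to E, since Ext^1(T, T^k) = 0; the identity of E
    differs from the composite by a map which factors through E -> T^n, so E
    lies in add T. *)
Lemma bongartz (T : fgmod A) (p : presentation T) :
    ext_vanishes p T ->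
    (forall X : fgmod A, perp0 T X -> ext_vanishes p X -> zero_module X) ->
  tilting T.
Proof.
move=> pT gens; split; [exact: pd_le_of_pres | exact: ext1_zero_of_vanishes |].
have [n [f f_gen]] := hom_projective_fg (regmod A) (pres1_proj p).
have [E] := @extension_exists _ _ (pow_presentation n p) (regmod A) (copair f).
have [i_inj ex q_surj] := ext_exact E.
have i_f j x : ext_i E (f j x) = ext_b E (pow_inj j (pres_d p x)).
  have := ext_square E (pow_inj j x).
  rewrite /= (bigD1 j) //= ffunE eqxx big1 ?addr0 => [->|k kj].
    congr (ext_b E _); apply/ffunP => k.
    by rewrite pow_mapE !ffunE; case: eqP => // _; rewrite linear0.
  by rewrite ffunE (negPf kj) linear0.
have pE : ext_vanishes p (ext_obj E).
  apply: (ext_vanishes_middle (ext_exact E)); last exact: ext_vanishes_pow.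
  move=> u; have [c cE] := f_gen u.
  (* The map y |-> \sum_j c j *: ext_b (pow_inj j y), by centrality of the c j. *)
  exists (copair (fun j => central _ (c j) \o (ext_b E \o pow_inj j)) \o
          tupling (fun j : 'I_n => idfun)) => x.
  rewrite cE linear_sum; apply: eq_bigr => j _.
  by rewrite /= ffunE [RHS]linearZ /= i_f.
(* The torsion-free quotient of E is orthogonal to T in both degrees. *)
have [k [P P_surj]] : Gen T (ext_obj E).
  have [X [q [q0_surj TX X0]]] := torsion_quotient (ext_obj E) pT.
  by apply: X0; apply: gens => //; apply: ext_vanishes_surj pE.
have [t tE] := P_surj (ext_i E (1 : A)).
have iE a : P (elt t a) = ext_i E a by rewrite [RHS]regmod_hom -tE -linearZ.
have [b bE] := pow_ext_vanishes (n:=n) (ext_vanishes_pow (n:=k) pT)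
  (elt t \o copair f).
have [s [si _]] :=
  @extension_univ _ _ _ _ _ E _ (elt t) b (fun x => esym (bE x)).
have [|h hE] := @descend _ _ _ _ (ext_q E) (idfun \- (P \o s)) q_surj.
  by move=> y /ex[a <-]; rewrite /= si iE subrr.
have addE : in_add T (ext_obj E).
  apply: (@in_add_of_sum _ _ k n _ s P (ext_q E) h) => x.
  by rewrite hE /= addrC subrK.
exists (ext_obj E), (pow n T), (ext_i E), (ext_q E).
by split=> //; apply: in_add_pow.
Qed.

End FiniteAlgebra.

(** * Adjoint functors between module categories *)

Section Functors.
Variables A B : pzRingType.
Implicit Types F : functor A B.

Lemma fmap_zero F (M N : fgmod A) (f : {linear M -> N}) x :
  (forall y, f y = 0) -> fmap F f x = 0.
Proof.
move=> f0; have -> : f = \0 by apply: linear_ext => y; rewrite f0.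
have := @fmap_add _ _ F M N \0 \0 x.
have -> : (\0 \+ \0 : {linear M -> N}) = \0.
  by apply: linear_ext => y /=; rewrite addr0.
by move/eqP; rewrite /= -subr_eq0 opprD addrA subrr sub0r oppr_eq0 => /eqP.
Qed.

Lemma fmap_zero_module F (X : fgmod A) : zero_module X -> zero_module (F X).
Proof.
by move=> X0 x; rewrite -[x](@fmap_id _ _ F); apply: fmap_zero => y; apply: X0.
Qed.

Lemma fmap_factor F (M N P : fgmod A) (g : {linear N -> P})
    (f : {linear M -> N}) (h : {linear M -> P}) x :
  (forall y, g (f y) = h y) -> fmap F g (fmap F f x) = fmap F h x.
Proof.
move=> gf; have <- : (g \o f : {linear M -> P}) = h by apply: linear_ext.
by rewrite fmap_comp.
Qed.

Lemma faithful_zero F (M N : fgmod A) (f : {linear M -> N}) :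
  fully_faithful F -> (forall x, fmap F f x = 0) -> forall x, f x = 0.
Proof.
move=> ff f0; have [g gK _] := ff M N.
have -> // : f = \0.
by apply/(can_inj gK)/linear_ext => x; rewrite f0 fmap_zero.
Qed.

Lemma full F (M N : fgmod A) (g : {linear F M -> F N}) :
  fully_faithful F -> exists f : {linear M -> N}, fmap F f =1 g.
Proof. by move=> ff; have [h _ hK] := ff M N; exists (h g); rewrite hK. Qed.

Definition preserves_surj F : Prop := forall (M N : fgmod A)
  (f : {linear M -> N}), surjective f -> surjective (fmap F f).

Definition preserves_projective F : Prop :=
  forall P : fgmod A, projective P -> projective (F P).

Section ImagePresentation.
Variables (F : functor A B).
Hypotheses (F_exact : exact_functor F) (F_proj : preserves_projective F).

Definition image_presentation (Z : fgmod A) (p : presentation Z) :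
    presentation (F Z) :=
  Presentation (F_proj (pres1_proj p)) (F_proj (pres0_proj p))
    (F_exact (pres_exact p)).

Lemma image_ext_vanishes (Z X : fgmod A) (p : presentation Z) :
    fully_faithful F ->
  ext_vanishes (image_presentation p) (F X) <-> ext_vanishes p X.
Proof.
move=> ff; split=> pX f.
  have [g gE] := pX (fmap F f).
  have [g' g'E] := full g ff; exists g' => x; apply/subr0_eq.
  pose D : {linear pres1 p -> X} := (g' \o pres_d p) \- f.
  apply: (@faithful_zero F _ _ D ff) => y.
  have DE : fmap F (g' \o pres_d p : {linear pres1 p -> X}) y =
            fmap F D y + fmap F f y.
    rewrite -[RHS](@fmap_add _ _ F _ _ D f); congr (fmap F _ y).
    by apply: linear_ext => z; rewrite /= subrK.
  by apply: (addIr (fmap F f y)); rewrite -DE fmap_comp /= g'E gE add0r.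
have [f' f'E] := full f ff; have [g gE] := pX f'.
by exists (fmap F g) => x; rewrite -f'E; apply: fmap_factor.
Qed.

End ImagePresentation.

End Functors.

Section Adjunction.
Variables (A B : pzRingType) (F : functor A B) (G : functor B A).
Hypothesis FG : adjoint F G.

(** The form in which adjunctions are used: a universal natural unit. *)
Lemma adjoint_unit : exists eta : forall X : fgmod A, {linear X -> G (F X)},
  [/\ forall (X : fgmod A) (Y : fgmod B) (k : {linear X -> G Y}),
        exists h : {linear F X -> Y}, forall x, fmap G h (eta X x) = k x,
      forall (X : fgmod A) (Y : fgmod B) (h h' : {linear F X -> Y}),
        (forall x, fmap G h (eta X x) = fmap G h' (eta X x)) -> h =1 h'
    & forall (X X' : fgmod A) (a : {linear X' -> X}) x,
        eta X (a x) = fmap G (fmap F a) (eta X' x)].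
Proof.
have [phi [phi_bij nat]] := FG.
pose eta (X : fgmod A) : {linear X -> G (F X)} := @phi X (F X) idfun.
have phiE (X : fgmod A) (Y : fgmod B) (h : {linear F X -> Y}) x :
    phi X Y h x = fmap G h (eta X x).
  have /= <- := nat X X (F X) Y idfun h idfun x; congr (phi X Y _ x).
  by apply: linear_ext => y; rewrite /= fmap_id.
exists eta; split=> [X Y k|X Y h h' hh' y|X X' a x].
- have [psi _ psiK] := phi_bij X Y.
  by exists (psi k) => x; rewrite -phiE psiK.
- have [psi phiK _] := phi_bij X Y.
  suff -> : h = h' by [].
  by apply/(can_inj phiK)/linear_ext => x; rewrite (phiE _ _ h) (phiE _ _ h').
rewrite -phiE; have := nat X X' (F X) (F X) a idfun idfun x.
rewrite /= fmap_id => <-; congr (phi X' (F X) _ x).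
exact: linear_ext.
Qed.

Lemma left_adjoint_surj : preserves_surj F.
Proof.
have [eta [_ eta_uniq eta_nat]] := adjoint_unit.
move=> X Y f f_surj; have [C [c [c_surj ex]]] := fg_cokernel (fmap F f).
move=> y; apply/ex; move: y; apply: (eta_uniq _ _ c \0) => z.
have [x <-] := f_surj z; rewrite [RHS]fmap_zero // eta_nat.
rewrite -[LHS](@fmap_comp _ _ G _ _ _ c (fmap F f)); apply: fmap_zero => w.
by apply/ex; exists w.
Qed.

Lemma right_adjoint_left_exact (X Y Z : fgmod B)
    (i : {linear X -> Y}) (q : {linear Y -> Z}) :
    injective i -> exact_at i q ->
  injective (fmap G i) /\ exact_at (fmap G i) (fmap G q).
Proof.
have [eta [eta_ex eta_uniq _]] := adjoint_unit.
move=> i_inj ex; split=> [|y].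
  apply: linear_inj => x ix; have [h hE] := eta_ex _ _ (elt x).
  rewrite -[x]elt1 -hE; apply: fmap_zero => z; apply: i_inj; rewrite linear0.
  move: z; apply: (eta_uniq _ _ (i \o h) \0) => a.
  by rewrite [RHS]fmap_zero // fmap_comp /= hE linearZ /= ix scaler0.
split=> [qy|[x <-]]; last first.
  rewrite -[LHS](@fmap_comp _ _ G _ _ _ q i); apply: fmap_zero => w.
  by apply/ex; exists w.
have [h hE] := eta_ex _ _ (elt y).
have qh z : q (h z) = 0.
  move: z; apply: (eta_uniq _ _ (q \o h) \0) => a.
  by rewrite [RHS]fmap_zero // fmap_comp /= hE linearZ /= qy scaler0.
have [k kE] := corestrict i_inj (fun z => (ex (h z)).1 (qh z)).
exists (fmap G k (eta (regmod A) (1 : A))).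
by rewrite (fmap_factor _ kE) hE elt1.
Qed.

Lemma left_adjoint_projective : preserves_surj G -> preserves_projective F.
Proof.
have [eta [eta_ex eta_uniq _]] := adjoint_unit.
move=> G_surj P P_proj M N g h g_surj.
have [k kE] := P_proj _ _ (fmap G g) (fmap G h \o eta P) (G_surj _ _ _ g_surj).
have [l lE] := eta_ex _ _ k; exists l.
by apply: (eta_uniq _ _ (g \o l)) => x; rewrite fmap_comp /= lE kE.
Qed.

Lemma adjoint_hom_zero (X : fgmod A) (Y : fgmod B) :
  (forall (h : {linear F X -> Y}) y, h y = 0) <->
  (forall (k : {linear X -> G Y}) x, k x = 0).
Proof.
have [eta [eta_ex eta_uniq _]] := adjoint_unit.
split=> [h0 k x|k0 h]; last first.
  apply: (eta_uniq _ _ h \0) => x; rewrite [RHS]fmap_zero //.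
  exact: (k0 (fmap G h \o eta X)).
by have [h <-] := eta_ex _ _ k; apply: fmap_zero => y; apply: h0.
Qed.

Lemma perp0_adjoint (T : fgmod A) (Y : fgmod B) :
  perp0 (F T) Y <-> perp0 T (G Y).
Proof. exact: adjoint_hom_zero. Qed.

Lemma ext_vanishes_adjoint (F_exact : exact_functor F)
    (F_proj : preserves_projective F) (Z : fgmod A) (p : presentation Z)
    (Y : fgmod B) :
  ext_vanishes (image_presentation F_exact F_proj p) Y -> ext_vanishes p (G Y).
Proof.
have [eta [eta_ex _ eta_nat]] := adjoint_unit.
move=> pY f; have [h hE] := eta_ex _ _ f; have [g gE] := pY h.
exists (fmap G g \o eta _) => x.
by rewrite /= eta_nat (fmap_factor _ gE) hE.
Qed.

(** Maps from the regular module detect elements, so fullness of F suffices. *)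
Lemma unit_surj : fully_faithful F ->
  forall X : fgmod A, exists u : {linear X -> G (F X)}, surjective u.
Proof.
have [eta [eta_ex _ eta_nat]] := adjoint_unit.
move=> ff X; exists (eta X) => y.
have [h hE] := eta_ex _ _ (elt y); have [h' h'E] := full h ff.
exists (h' (1 : A)); rewrite eta_nat -[RHS]elt1 -hE.
by congr (fmap G _ _); apply: linear_ext.
Qed.

(** The triangle identity makes the image of the counit under G split. *)
Lemma counit_surj (Y : fgmod B) :
  exists c : {linear F (G Y) -> Y}, surjective (fmap G c).
Proof.
have [eta [eta_ex _ _]] := adjoint_unit.
have [c cE] := eta_ex _ _ (idfun : {linear G Y -> G Y}).
by exists c => y; exists (eta _ y); rewrite cE.
Qed.

End Adjunction.

Lemma two_adjoints_exact (A B : pzRingType) (L : functor B A) (F : functor A B)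
    (G : functor B A) : adjoint L F -> adjoint F G -> exact_functor F.
Proof.
move=> LF FG X Y Z f g [f_inj ex g_surj].
have [Ff_inj Fex] := right_adjoint_left_exact LF f_inj ex.
by split=> //; apply: (left_adjoint_surj FG).
Qed.

(** * Direct sums and isomorphisms *)

Section DirectSums.
Variables (A : pzRingType) (M N : fgmod A).

Lemma perp0_dsum (X : fgmod A) :
  perp0 (dsum M N) X <-> perp0 M X /\ perp0 N X.
Proof.
split=> [TX|[MX NX] f x].
  split=> f x.
    by have /= := TX (dsum_copair f \0) (x, 0); rewrite addr0.
  by have /= := TX (dsum_copair \0 f) (0, x); rewrite add0r.
rewrite dsum_hom_eq; have /= -> := MX (f \o dsum_inl M N) x.1.
by have /= -> := NX (f \o dsum_inr M N) x.2; rewrite addr0.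
Qed.

Variables (p : presentation M) (q : presentation N).

Definition dsum_map (X X' Y Y' : lmodType A) (f : {linear X -> X'})
    (g : {linear Y -> Y'}) : {linear (X * Y)%type -> (X' * Y')%type} :=
  dsum_pair (f \o (fst : {linear (X * Y)%type -> X}))
            (g \o (snd : {linear (X * Y)%type -> Y})).

Lemma dsum_short_exact : short_exact
  (dsum_map (pres_d p) (pres_d q)) (dsum_map (pres_e p) (pres_e q)).
Proof.
split=> [|[y z]|[y z]].
- move=> [x y] [x' y'] /eqP; rewrite xpair_eqE /=.
  by move=> /andP[/eqP/(pres_d_inj p)-> /eqP/(pres_d_inj q)->].
- split=> [/eqP|[[x x'] <-]]; last by rewrite /= !pres_ed.
  rewrite xpair_eqE /= => /andP[/eqP/pres_ker[x <-] /eqP/pres_ker[x' <-]].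
  by exists (x, x').
have [x <-] := pres_e_surj p y; have [x' <-] := pres_e_surj q z.
by exists (x, x').
Qed.

Definition dsum_presentation : presentation (dsum M N) :=
  @Presentation _ (dsum M N) (dsum (pres1 p) (pres1 q))
    (dsum (pres0 p) (pres0 q)) _ _
    (dsum_projective (pres1_proj p) (pres1_proj q))
    (dsum_projective (pres0_proj p) (pres0_proj q)) dsum_short_exact.

Lemma dsum_ext_vanishes (X : lmodType A) :
  ext_vanishes dsum_presentation X <-> ext_vanishes p X /\ ext_vanishes q X.
Proof.
split=> [TX|[MX NX] f].
  split=> f.
    have [g gE] := TX (dsum_copair f \0).
    exists (g \o dsum_inl _ _) => x; have /= := gE (x, 0).
    by rewrite !linear0 addr0.
  have [g gE] := TX (dsum_copair \0 f).
  exists (g \o dsum_inr _ _) => x; have /= := gE (0, x).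
  by rewrite !linear0 add0r.
have [g gE] := MX (f \o dsum_inl _ _); have [h hE] := NX (f \o dsum_inr _ _).
by exists (dsum_copair g h) => x; rewrite /= gE hE [RHS]dsum_hom_eq.
Qed.

End DirectSums.

Lemma perp0_inj (A : pzRingType) (T X Y : fgmod A) (f : {linear X -> Y}) :
  injective f -> perp0 T Y -> perp0 T X.
Proof.
by move=> f_inj TY g x; apply: f_inj; rewrite linear0; apply: (TY (f \o g)).
Qed.

Lemma perp0_middle (A : pzRingType) (N E Z X : fgmod A)
    (i : {linear N -> E}) (q : {linear E -> Z}) :
  short_exact i q -> perp0 N X -> perp0 E X <-> perp0 Z X.
Proof.
move=> [i_inj ex q_surj] NX; split=> [EX g z|ZX f y].
  by have [y <-] := q_surj z; apply: (EX (g \o q)).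
have [|g gE] := @descend _ _ _ _ q f q_surj.
  by move=> z /ex[n <-]; apply: (NX (f \o i)).
by rewrite -gE ZX.
Qed.

(** * Recollements *)

Section Recollement.
Variables (A' A A'' : pzRingType) (r : recollement A' A A'').
Local Notation iu := (i_ustar r).
Local Notation il := (i_lstar r).
Local Notation ish := (i_ushriek r).
Local Notation js := (j_lshriek r).
Local Notation ju := (j_ustar r).
Local Notation jl := (j_lstar r).

Lemma ju_il_zero (X : fgmod A') : zero_module (ju (il X)).
Proof.
apply/im_i_ker_j; exists X, (idfun : {linear il X -> il X}).
by exists id.
Qed.

Lemma hom_js_il (Y : fgmod A'') (X : fgmod A') (f : {linear js Y -> il X}) y :
  f y = 0.
Proof.
move: f y; apply/(adjoint_hom_zero (adj_j_lshriek r)) => k x.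
exact: ju_il_zero.
Qed.

Lemma hom_il_jl (X : fgmod A') (Y : fgmod A'') (f : {linear il X -> jl Y}) x :
  f x = 0.
Proof.
move: f x; apply/(adjoint_hom_zero (adj_j_lstar r)) => k x.
by rewrite (ju_il_zero x) linear0.
Qed.

Lemma il_exact : exact_functor il.
Proof. exact: two_adjoints_exact (adj_i_ustar r) (adj_i_ushriek r). Qed.

Lemma js_projective : preserves_projective js.
Proof.
apply: (left_adjoint_projective (adj_j_lshriek r)).
exact: left_adjoint_surj (adj_j_lstar r).
Qed.

(** The functor i^! is only known to respect short exact sequences of finitely
    generated modules, while the kernel of a surjection onto i_*P need not be
    finitely generated over a general ring.  For a surjection A^m -> i_*P one
    replaces this kernel by the image C of j_! j^* A^m -> A^m: the quotient
    A^m / C is killed by j^*, hence of the form i_*X, and the induced X -> P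
    splits; the splitting lifts to A^m since i^! is exact on C -> A^m -> i_*X. *)
Lemma il_projective : exact_functor ish -> preserves_projective il.
Proof.
move=> ish_exact P P_proj; have [m [v v_gen]] := fgmodP (il P).
pose F := pow m (regmod A).
pose pi : {linear F -> il P} := combination v.
have pi_surj : surjective pi by apply: combination_surj.
have [c c_surj] := counit_surj (adj_j_lshriek r) F.
have [C [c1 [i [c1_surj i_inj ic1]]]] := fg_image_factor c.
have [Q [q [q_surj qex]]] := fg_cokernel i.
have ses : short_exact i q by [].
have juQ0 : zero_module (ju Q).
  move=> y; have [x <-] := left_adjoint_surj (adj_j_lstar r) q_surj y.
  have [z <-] := c_surj x; rewrite -[LHS](@fmap_comp _ _ ju _ _ _ q c).
  by apply: fmap_zero => w; apply/qex; exists (c1 w).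
have [X isoX] := (im_i_ker_j r Q).2 juQ0.
have [th [th' th'K thK]] := isoX; have [om omK] := isomorphic_sym isoX.
have [pb pbE] : exists pb : {linear Q -> il P}, forall x, pb (q x) = pi x.
  apply: descend => // x /qex[y <-]; have [w <-] := c1_surj y.
  by rewrite ic1; apply: (hom_js_il (pi \o c)).
(* Both p and its surjectivity come from A^m / C -> i_*P by full faithfulness. *)
have [p pE] := full (pb \o th : {linear il X -> il P}) (ff_i_lstar r).
have p_surj : surjective p.
  have [Y [d [d_surj dex]]] := fg_cokernel p.
  move=> x; apply/dex; move: x; apply: (faithful_zero (ff_i_lstar r)) => y.
  have [z zE] := pi_surj y; rewrite -zE -pbE -(thK (q z)) -[pb _]pE.
  rewrite -[LHS](@fmap_comp _ _ il _ _ _ d p).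
  by apply: fmap_zero => w; apply/dex; exists w.
have [s sE] := P_proj _ _ p idfun p_surj.
have [eta [eta_ex eta_uniq _]] := adjoint_unit (adj_i_ushriek r).
have [_ _ ishq_surj] := ish_exact _ _ _ _ _ ses.
pose sg : {linear il P -> Q} := th \o fmap il s.
have [k kE] := P_proj _ _ (fmap ish q) (fmap ish sg \o eta P) ishq_surj.
have [t tE] := eta_ex _ _ k.
have qt : forall x, q (t x) = sg x.
  by apply: (eta_uniq _ _ (q \o t) sg) => x; rewrite fmap_comp /= tE kE.
have pit x : pi (t x) = x.
  rewrite -pbE qt /sg /= -[LHS]pE -[LHS](@fmap_comp _ _ il _ _ _ p s).
  rewrite -[RHS](@fmap_id _ _ il); congr (fmap il _ x).
  exact: linear_ext.
move=> M N g h g_surj.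
have [l lE] := pow_projective (regular_projective (A:=A)) (h \o pi) g_surj.
by exists (l \o t) => x; rewrite /= lE; apply: (congr1 h (pit x)).
Qed.

End Recollement.

(** * Gluing *)

Section Gluing.
Variables (A' A A'' : pzRingType) (r : recollement A' A A'').
Variables (T' : fgmod A') (T'' : fgmod A'').

Lemma perp0_il_ff (X : fgmod A') :
  perp0 (i_lstar r T') (i_lstar r X) <-> perp0 T' X.
Proof.
split=> TX f x.
  by apply: (faithful_zero (ff_i_lstar r)) => y; apply: TX.
have [g gE] := full f (ff_i_lstar r).
by rewrite -gE; apply: fmap_zero => y; apply: TX.
Qed.

Lemma glued_torsionfreeP (Y : fgmod A) :
  glued_torsionfree r (perp0 T') (perp0 T'') Y <->
  perp0 (j_lshriek r T'') Y /\ perp0 (i_lstar r T') Y.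
Proof.
rewrite /glued_torsionfree.
rewrite (perp0_adjoint (adj_i_ushriek r)) (perp0_adjoint (adj_j_lshriek r)).
by split=> -[].
Qed.

Lemma glued_torsionfree_il (X : fgmod A') :
  perp0 T' X -> glued_torsionfree r (perp0 T') (perp0 T'') (i_lstar r X).
Proof.
move=> TX; apply/glued_torsionfreeP; split; last exact/perp0_il_ff.
exact: hom_js_il.
Qed.

Lemma glued_torsionfree_jl (X : fgmod A'') :
  perp0 T'' X -> glued_torsionfree r (perp0 T') (perp0 T'') (j_lstar r X).
Proof.
move=> TX; apply/glued_torsionfreeP; split=> f x; last exact: hom_il_jl.
move: f x; apply/(adjoint_hom_zero (adj_j_lstar r)) => f x.
have [u u_surj] := unit_surj (adj_j_lshriek r) (ff_j_lshriek r) T''.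
by have [y <-] := u_surj x; apply: (TX (f \o u)).
Qed.

(** A torsion pair is determined by its torsion-free part, so it suffices to
    compare the latter.  On the glued side, being torsion is tested by the maps
    to i_*X and j_*X with X torsion-free, which are themselves torsion-free;
    conversely a torsion-free quotient of a glued torsion module is killed by
    j^*, hence is some i_*X. *)
Lemma glued_torsion_gen (p' : presentation T') (p'' : presentation T'')
    (T : fgmod A) (p : presentation T) :
    ext_vanishes p' T' -> ext_vanishes p'' T'' -> ext_vanishes p T ->
    eq_subcat (glued_torsionfree r (perp0 T') (perp0 T'')) (perp0 T) ->
  eq_subcat (glued_torsion r (Gen T') (Gen T'')) (Gen T).
Proof.
move=> pT' pT'' pT freeE M; split=> [[iM jM]|TM]; last first.
  split; [apply: (gen_of_left_orthogonal pT') => X f _ TX |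
          apply: (gen_of_left_orthogonal pT'') => X f _ TX]; move: f.
    apply/(adjoint_hom_zero (adj_i_ustar r)) => f x.
    by apply: (gen_perp0 _ _ TM); apply/freeE/glued_torsionfree_il.
  apply/(adjoint_hom_zero (adj_j_lstar r)) => f x.
  by apply: (gen_perp0 _ _ TM); apply/freeE/glued_torsionfree_jl.
apply: (gen_of_left_orthogonal pT) => X f f_surj /freeE Xfree.
have juX0 : zero_module (j_ustar r X).
  move=> y; have [x <-] := left_adjoint_surj (adj_j_lstar r) f_surj y.
  by apply: (gen_perp0 _ _ jM); case: Xfree.
have [Y isoY] := (im_i_ker_j r X).2 juX0.
have [th th_bij] := isoY; have [om om_bij] := isomorphic_sym isoY.
have TY : perp0 T' Y.
  have [_ TX] := (glued_torsionfreeP X).1 Xfree.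
  by apply/perp0_il_ff; apply: perp0_inj TX; apply: bij_inj th_bij.
move=> x; apply: (bij_inj om_bij); rewrite linear0.
move: x; apply: (adjoint_hom_zero (adj_i_ustar r) M Y).1 (om \o f) => h y.
exact: gen_perp0 iM TY.
Qed.

End Gluing.

(** The universal extension of i_*T' by copies of N = j_!T''.  Of the four
    groups Ext^1 between N and i_*T', only Ext^1(i_*T', N) can be non-zero, and
    as Hom(P1, N) is finitely generated over the base ring, the extension E whose
    class is the family of generators has Ext^1(E, N) = 0; the other vanishings
    pass to E along 0 -> N^n -> E -> i_*T' -> 0. *)
Lemma glued_tilting_exists (R : comPzRingType) (A' A'' : pzRingType)
    (A : algType R) (A_fg : finitely_generated (A : lmodType R))
    (r : recollement A' A A'') (T' : fgmod A') (T'' : fgmod A'')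
    (p' : presentation T') (p'' : presentation T'')
    (hi : exact_functor (i_ushriek r)) (hj : exact_functor (j_lshriek r)) :
    ext_vanishes p' T' -> ext_vanishes p'' T'' ->
    (forall X, perp0 T' X -> ext_vanishes p' X -> zero_module X) ->
    (forall X, perp0 T'' X -> ext_vanishes p'' X -> zero_module X) ->
  exists M : fgmod A, let T := dsum (j_lshriek r T'') M in
    exists p : presentation T,
    [/\ ext_vanishes p T,
        forall X, perp0 T X -> ext_vanishes p X -> zero_module X
      & eq_subcat (glued_torsionfree r (perp0 T') (perp0 T'')) (perp0 T)].
Proof.
move=> pT' pT'' gens' gens''.
set N := j_lshriek r T''; set L := i_lstar r T'.
pose pN : presentation N := image_presentation hj (@js_projective _ _ _ r) p''.
pose pL : presentation L :=
  image_presentation (@il_exact _ _ _ r) (il_projective hi) p'.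
have NN : ext_vanishes pN N.
  by apply/image_ext_vanishes => //; apply: ff_j_lshriek.
have LL : ext_vanishes pL L.
  by apply/image_ext_vanishes => //; apply: ff_i_lstar.
have NiX X : ext_vanishes pN (i_lstar r X).
  by move=> f; exists \0 => x; rewrite [RHS]hom_js_il.
have [n [f f_gen]] := hom_projective_fg A_fg N (pres1_proj pL).
have [E] := @extension_exists _ _ pL (pow n N) (tupling f).
have [pE pE_ext] := horseshoe (pow_presentation n pN) E.
have powN X : ext_vanishes pN X -> ext_vanishes (pow_presentation n pN) X.
  exact: pow_ext_vanishes.
have NE : ext_vanishes pN (ext_obj E).
  apply: (ext_vanishes_middle (ext_exact E)); last exact: NiX.
  move=> u; have [g gE] := ext_vanishes_pow NN u.
  by exists (ext_i E \o g) => x; rewrite /= gE.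
have EN : ext_vanishes pE N.
  have [_ H _] := pE_ext N; apply: H; first exact: powN.
  move=> u; have [c cE] := f_gen u.
  exists (copair (fun i => central N (c i))) => x; rewrite cE.
  by apply: eq_bigr => i _; rewrite ffunE.
have EL : ext_vanishes pE L.
  by have [H _ _] := pE_ext L; apply: H => //; apply/powN/NiX.
have EE : ext_vanishes pE (ext_obj E).
  apply: (ext_vanishes_middle (ext_exact E)) EL => u.
  have [g gE] := ext_vanishes_pow EN u.
  by exists (ext_i E \o g) => x; rewrite /= gE.
have perpE X : perp0 N X -> perp0 (ext_obj E) X <-> perp0 L X.
  move=> NX; apply: (perp0_middle (ext_exact E)) => g x.
  exact: perp0_pow.
exists (ext_obj E), (dsum_presentation pN pE); split.
- by apply/dsum_ext_vanishes; split; apply: ext_vanishes_dsum.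
- move=> X /perp0_dsum[NX EX] /dsum_ext_vanishes[pNX pEX].
  have juX : zero_module (j_ustar r X).
    apply: gens''; first exact/(perp0_adjoint (adj_j_lshriek r)).
    exact: (ext_vanishes_adjoint (adj_j_lshriek r)) pNX.
  have [Y isoY] := (im_i_ker_j r X).2 juX.
  have [th th_bij] := isoY; have [om om_bij] := isomorphic_sym isoY.
  suff Y0 : zero_module (i_lstar r Y).
    by move=> x; apply: (bij_inj om_bij); rewrite linear0; apply: Y0.
  apply: fmap_zero_module; apply: gens'.
    apply/(perp0_il_ff r)/(perp0_inj (bij_inj th_bij)).
    exact/(perpE X).
  have [_ _ H] := pE_ext (i_lstar r Y).
  apply/(image_ext_vanishes (@il_exact _ _ _ r) (il_projective hi)).
    exact: ff_i_lstar.
  apply: H => [|g x]; last by apply: perp0_pow; apply: hom_js_il.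
  apply: ext_vanishes_surj pEX; last first.
    by have [om' _ omK] := om_bij; move=> y; exists (om' y).
move=> X; rewrite glued_torsionfreeP perp0_dsum.
by split=> -[NX ?]; split=> //; apply/(perpE X).
Qed.

Theorem theorem1p1 (R' R R'' : comPzRingType)
  (A' : algType R') (A : algType R) (A'' : algType R'')
  (hA' : artin_algebra A') (hA : artin_algebra A) (hA'' : artin_algebra A'')
  (r : recollement A' A A'')
  (T' : fgmod A') (T'' : fgmod A'')
  (hT' : tilting T') (hT'' : tilting T'')
  (hi : exact_functor (i_ushriek r)) (hj : exact_functor (j_lshriek r)) :
  exists M : fgmod A,
    let T := dsum (j_lshriek r T'') M in
    [/\ tilting T,
        eq_subcat (glued_torsion r (Gen T') (Gen T'')) (Gen T)
      & eq_subcat (glued_torsionfree r (perp0 T') (perp0 T'')) (perp0 T)].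
Proof.
have [_ A_fg] := hA.
have [p' [pT' gens']] := tilting_generates hT'.
have [p'' [pT'' gens'']] := tilting_generates hT''.
have [M [p [pT gens freeE]]] :=
  glued_tilting_exists A_fg hi hj pT' pT'' gens' gens''.
exists M; split=> //; first exact: (bongartz A_fg pT).
exact: (glued_torsion_gen pT' pT'' pT).
Qed.
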